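(* Let $\boldsymbol{Y}^{(1)},\dots,\boldsymbol{Y}^{(N)}$ be multi-object trajectories, $L=\sum_{n=1}^N|\boldsymbol{Y}^{(n)}|$, with existence lists $\xi^{(n)}\in\mathbb{B}^L$ and trajectory lists $\chi^{(n)}\in\mathbb{T}^L$, $n=1,\dots,N$, where $\mathbb{B}=\{0,1\}$, and let $Q_\omega^{(r)}$ be the cost function defined in the context. For any $\eta\in\mathbb{B}^L$ and $\omega\in\Omega^{(1:N)}(\eta)$, let $$[\tau_1^*(\eta,\omega),\dots,\tau_L^*(\eta,\omega)]=\arg\min_{\tau\in\mathbb{T}^L}Q_\omega^{(r)}(\eta,\tau).$$ If $\eta_\ell=0$, or $\xi^{(n)}_{\omega(n,\ell)}=0$ for all $n=1,\dots,N$, then $\tau_\ell^*(\eta,\omega)=\boldsymbol{0}$. Otherwise, $$\tau_\ell^*(\eta,\omega)=\arg\min_{\tau_\ell\in\mathbb{T}}\ \sum_{n:\,\xi^{(n)}_{\omega(n,\ell)}=1}\frac{[d_{\mathbb{T}}^{(c)}(\tau_\ell,\chi^{(n)}_{\omega(n,\ell)})]^r}{\kappa(\|\eta\|_1,\|\xi^{(n)}\|_1)}.$$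
   Context: Let $\mathbb{T}$ be the space of trajectories: a trajectory is a function from time instances in a finite time window $\mathbb{K}$ to a state space $\mathbb{X}$, defined on a subset of $\mathbb{K}$ (its domain); $\boldsymbol{0}\in\mathbb{T}$ is the function mapping every element of $\mathbb{K}$ to zero. A multi-object trajectory is a (finite) multi-set of elements of $\mathbb{T}$, and $|\cdot|$ is its cardinality counted with multiplicity. Let $r$ be a positive integer, $p\ge0$, $c\in[p,\sqrt[r]{2}\,p]$, let $d_{\mathbb{T}}$ be a trajectory distance on $\mathbb{T}$, and $d_{\mathbb{T}}^{(c)}(y,z)=\min\{d_{\mathbb{T}}(y,z),c\}$. Let $\kappa$ be a non-negative real function of pairs of non-negative integers with $\kappa(s,m)=\kappa(m,s)$. Existence and trajectory lists: a multi-object trajectory $\{\boldsymbol{X}_1,\dots,\boldsymbol{X}_m\}$ with $m\le L$ has existence list $\eta\in\mathbb{B}^L$ and trajectory list $\tau\in\mathbb{T}^L$ given by $\eta_\ell=1$, $\tau_\ell=\boldsymbol{X}_\ell$ for $\ell=1,\dots,m$, and $\eta_\ell=0$, $\tau_\ell=\boldsymbol{0}$ otherwise. Existence assignments: for $\eta\in\mathbb{B}^L$, $\Omega^{(n)}(\eta)$ is the set of permutations $\pi$ of $\{1,\dots,L\}$ such that $\eta_\ell=1\Rightarrow\xi^{(n)}_{\pi(\ell)}=1$ if $\|\eta\|_1\le\|\xi^{(n)}\|_1$, or $\xi^{(n)}_{\pi(\ell)}=1\Rightarrow\eta_\ell=1$ if $\|\eta\|_1>\|\xi^{(n)}\|_1$.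 $\Omega^{(1:N)}(\eta)=\Omega^{(1)}(\eta)\times\dots\times\Omega^{(N)}(\eta)$, and $\omega=(\omega^{(1)},\dots,\omega^{(N)})$ is viewed as an $N\times L$ matrix with entries $\omega(n,\ell)=\omega^{(n)}(\ell)$. Cost function: $$Q_\omega^{(r)}(\eta,\tau)=\sum_{\ell=1}^L\Big(\eta_\ell\,\phi_{\omega,\ell}^{(r)}(\eta,\tau_\ell)+(1-\eta_\ell)\,\bar\phi_{\omega,\ell}^{(r)}(\eta)\Big),$$ $$\phi_{\omega,\ell}^{(r)}(\eta,\tau_\ell)=\sum_{n=1}^N\frac{\xi^{(n)}_{\omega(n,\ell)}[d_{\mathbb{T}}^{(c)}(\tau_\ell,\chi^{(n)}_{\omega(n,\ell)})]^r+(1-\xi^{(n)}_{\omega(n,\ell)})\,p^r}{\kappa(\|\eta\|_1,\|\xi^{(n)}\|_1)},\qquad \bar\phi_{\omega,\ell}^{(r)}(\eta)=\sum_{n=1}^N\frac{\xi^{(n)}_{\omega(n,\ell)}\,p^r}{\kappa(\|\eta\|_1,\|\xi^{(n)}\|_1)}.$$ Here ''arg min'' stands for a minimizer; the solution of the last minimization problem in the claim might not be unique, and any minimizer of the cost is sufficient. *)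

(* Defs.v *)
From HB Require Import structures.
From mathcomp Require Export all_boot all_order all_algebra all_fingroup.
From mathcomp Require Export finmap multiset.
From mathcomp Require Export reals exp.

Set Implicit Arguments.
Unset Strict Implicit.
Unset Printing Implicit Defensive.

Import Order.TTheory GRing.Theory Num.Theory.
Local Open Scope ring_scope.
Local Open Scope mset_scope.

(* A trajectory is a partial function from the time window K to the state
   space X; its domain is the set of k such that x k != None. *)
Definition traj (K : finType) (X : zmodType) := {ffun K -> option X}.

HB.instance Definition _ (K : finType) (X : zmodType) :=
  Choice.on (traj K X).

(* The trajectory with full domain that is constantly zero; in particular it is
   not the nowhere-defined trajectory. *)
Definition traj0 (K : finType) (X : zmodType) : traj K X :=
  [ffun=> Some (0 : X)].

(* Neither the triangle inequality nor separation is required, so metrics are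
   a special case. *)
Definition is_distance (R : realType) (T : Type) (d : T -> T -> R) : Prop :=
  [/\ forall x y, 0 <= d x y,
      forall x, d x x = 0 &
      forall x y, d x y = d y x].

Definition is_argmin (R : realType) (A : Type) (f : A -> R) (a : A) : Prop :=
  forall b, f a <= f b.

(* xi and chi are the existence and trajectory lists of the multiset Y for some
   enumeration s of Y: a multiset does not determine the order of the lists. *)
Definition lists_of (K : finType) (X : zmodType) (L : nat)
    (Y : {mset traj K X}) (xi : {ffun 'I_L -> bool})
    (chi : {ffun 'I_L -> traj K X}) : Prop :=
  exists s : seq (traj K X),
    [/\ perm_eq s (enum_mset Y),
        (size s <= L)%N,
        forall l : 'I_L, xi l = (l < size s)%N &
        forall l : 'I_L, chi l = nth (traj0 K X) s l].

Definition norm1 (L : nat) (eta : {ffun 'I_L -> bool}) : nat :=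
  \sum_(l < L) eta l.

Definition Omega (L : nat) (xi eta : {ffun 'I_L -> bool}) : {set 'S_L} :=
  [set pi : 'S_L |
    if (norm1 eta <= norm1 xi)%N then [forall l, eta l ==> xi (pi l)]
    else [forall l, xi (pi l) ==> eta l]].

Definition cutoff (R : realType) (T : Type) (d : T -> T -> R) (c : R)
    (y z : T) : R := Num.min (d y z) c.

(* In the three definitions below a / 0 = 0, which is only relevant when kappa
   vanishes. *)

Definition phi (R : realType) (K : finType) (X : zmodType) (N L r : nat)
    (p c : R) (d : traj K X -> traj K X -> R) (kappa : nat -> nat -> R)
    (xi : 'I_N -> {ffun 'I_L -> bool}) (chi : 'I_N -> {ffun 'I_L -> traj K X})
    (omega : 'I_N -> 'S_L) (l : 'I_L)
    (eta : {ffun 'I_L -> bool}) (t : traj K X) : R :=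
  \sum_(n < N)
    ((xi n (omega n l))%:R * cutoff d c t (chi n (omega n l)) ^+ r
     + (1 - (xi n (omega n l))%:R) * p ^+ r)
    / kappa (norm1 eta) (norm1 (xi n)).

Definition phibar (R : realType) (N L r : nat) (p : R)
    (kappa : nat -> nat -> R) (xi : 'I_N -> {ffun 'I_L -> bool})
    (omega : 'I_N -> 'S_L) (l : 'I_L) (eta : {ffun 'I_L -> bool}) : R :=
  \sum_(n < N)
    ((xi n (omega n l))%:R * p ^+ r) / kappa (norm1 eta) (norm1 (xi n)).

Definition object_cost (R : realType) (K : finType) (X : zmodType) (N L r : nat)
    (c : R) (d : traj K X -> traj K X -> R) (kappa : nat -> nat -> R)
    (xi : 'I_N -> {ffun 'I_L -> bool}) (chi : 'I_N -> {ffun 'I_L -> traj K X})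
    (omega : 'I_N -> 'S_L) (l : 'I_L)
    (eta : {ffun 'I_L -> bool}) (t : traj K X) : R :=
  \sum_(n < N | xi n (omega n l))
    cutoff d c t (chi n (omega n l)) ^+ r / kappa (norm1 eta) (norm1 (xi n)).

Definition Q (R : realType) (K : finType) (X : zmodType) (N L r : nat)
    (p c : R) (d : traj K X -> traj K X -> R) (kappa : nat -> nat -> R)
    (xi : 'I_N -> {ffun 'I_L -> bool}) (chi : 'I_N -> {ffun 'I_L -> traj K X})
    (omega : 'I_N -> 'S_L)
    (eta : {ffun 'I_L -> bool}) (tau : {ffun 'I_L -> traj K X}) : R :=
  \sum_(l < L)
    ((eta l)%:R * phi r p c d kappa xi chi omega l eta (tau l)
     + (1 - (eta l)%:R) * phibar r p kappa xi omega l eta).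

(* The cost does not depend on the l-th trajectory for these l. *)
Definition vacuous (N L : nat) (xi : 'I_N -> {ffun 'I_L -> bool})
    (omega : 'I_N -> 'S_L) (eta : {ffun 'I_L -> bool}) (l : 'I_L) : bool :=
  ~~ eta l || [forall n, ~~ xi n (omega n l)].

(* Main.v *)
(* The cost is a sum over [l] of terms each depending on [tau] through
   [tau l] only, and up to an additive constant the [l]-th term is the per-object
   cost, or is constant when [l] is vacuous. So the entries can be minimized
   independently, and the vacuous ones are arbitrary. *)

Require Import Defs.

Set Implicit Arguments.
Unset Strict Implicit.
Unset Printing Implicit Defensive.

Import Order.TTheory GRing.Theory Num.Theory.
Local Open Scope ring_scope.
Local Open Scope mset_scope.

(** Changing the single entry [t i] to [b] affects only the [i]-th term, so the other terms cancel;
    the converse is a termwise comparison. *)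
Lemma argmin_separable (R : realType) (I : finType) (T : Type) (P : pred I)
    (f : I -> T -> R) (t : {ffun I -> T}) :
  is_argmin (fun u : {ffun I -> T} => \sum_(i | P i) f i (u i)) t <->
  forall i, P i -> is_argmin (f i) (t i).
Proof.
split=> [tmin i Pi b | tmin u]; last by apply: ler_sum => i /tmin.
have := tmin [ffun j => if j == i then b else t j].
rewrite (bigD1 i) //= [leRHS](bigD1 i) //= ffunE eqxx.
have -> : \sum_(j | P j && (j != i)) f j ([ffun j => if j == i then b else t j] j)
          = \sum_(j | P j && (j != i)) f j (t j).
  by apply: eq_bigr => j /andP[_ /negPf ji]; rewrite ffunE ji.
by rewrite lerD2r.
Qed.

Lemma is_argminDl (R : realType) (A : Type) (C : R) (f g : A -> R) (a : A) :
  (forall b, f b = C + g b) -> is_argmin f a <-> is_argmin g a.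
Proof. by move=> fE; split=> amin b; have := amin b; rewrite !fE lerD2l. Qed.

Section CostDecomposition.
Variables (R : realType) (K : finType) (X : zmodType) (N L r : nat) (p c : R).
Variables (d : traj K X -> traj K X -> R) (kappa : nat -> nat -> R).
Variables (xi : 'I_N -> {ffun 'I_L -> bool}).
Variables (chi : 'I_N -> {ffun 'I_L -> traj K X}).
Variables (omega : 'I_N -> 'S_L) (eta : {ffun 'I_L -> bool}).

(** Penalty for the [n] in which [l] is matched to no existing object; free of [tau], it only shifts
    the cost by a constant. *)
Let missed_cost (l : 'I_L) : R :=
  \sum_(n < N | ~~ xi n (omega n l)) p ^+ r / kappa (norm1 eta) (norm1 (xi n)).

(** As [xi n (omega n l)] is 0 or 1, each [n] contributes either the penalty or the cut-off
    distance, never both. *)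
Lemma phiE l t :
  phi r p c d kappa xi chi omega l eta t
  = missed_cost l + object_cost r c d kappa xi chi omega l eta t.
Proof.
rewrite /phi (bigID (fun n => xi n (omega n l))) /= addrC.
congr (_ + _); apply: eq_bigr => n.
  by move=> /negPf ->; rewrite mul0r add0r subr0 mul1r.
by move=> ->; rewrite mul1r subrr mul0r addr0.
Qed.

Lemma object_cost0 l t : (forall n, ~~ xi n (omega n l)) ->
  object_cost r c d kappa xi chi omega l eta t = 0.
Proof. by move=> xi0; apply: big_pred0 => n; apply/negbTE/xi0. Qed.

(** Collects everything free of [tau] in the first sum, so that the second is separable. *)
Lemma QE tau :
  Q r p c d kappa xi chi omega eta tau
  = \sum_(l < L) (if eta l then missed_cost l
                  else phibar r p kappa xi omega l eta)
    + \sum_(l < L | ~~ vacuous xi omega eta l)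
        object_cost r c d kappa xi chi omega l eta (tau l).
Proof.
rewrite [X in _ = _ + X]big_mkcond -big_split; apply: eq_bigr => l _ /=.
rewrite phiE /vacuous; case: (eta l) => /=; last first.
  by rewrite mul0r add0r subr0 mul1r addr0.
rewrite mul1r subrr mul0r addr0.
(* Here [eta l] holds, so [l] is vacuous only if no [xi n] matches it; its object cost is then an
   empty sum. *)
by case: forallP => //= xi0; rewrite object_cost0.
Qed.

(** The three claims of the theorem are all read off from this equivalence. *)
Lemma Q_argminP tau :
  is_argmin (Q r p c d kappa xi chi omega eta) tau <->
  forall l, ~~ vacuous xi omega eta l ->
    is_argmin (object_cost r c d kappa xi chi omega l eta) (tau l).
Proof.
rewrite (is_argminDl _ QE).
exact: (argmin_separable _ (object_cost r c d kappa xi chi omega ^~ eta)).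
Qed.

End CostDecomposition.

Theorem proposition6 (R : realType) (K : finType) (X : zmodType)
    (r : nat) (p c : R)
    (d : traj K X -> traj K X -> R) (kappa : nat -> nat -> R)
    (N L : nat) (Y : 'I_N -> {mset traj K X})
    (xi : 'I_N -> {ffun 'I_L -> bool})
    (chi : 'I_N -> {ffun 'I_L -> traj K X})
    (hr : (0 < r)%N) (hp : 0 <= p) (hc : p <= c <= 2 `^ (r%:R^-1) * p)
    (hd : is_distance d)
    (hkappa0 : forall s m, 0 <= kappa s m)
    (hkappaC : forall s m, kappa s m = kappa m s)
    (hL : L = (\sum_(n < N) size (enum_mset (Y n)))%N)
    (hlists : forall n, lists_of (Y n) (xi n) (chi n))
    (eta : {ffun 'I_L -> bool}) (omega : 'I_N -> 'S_L)
    (homega : forall n, omega n \in Omega (xi n) eta) :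
  [/\ (* the stated tau* is a minimizer of the cost *)
      forall tau : {ffun 'I_L -> traj K X},
        (forall l, vacuous xi omega eta l -> tau l = traj0 K X) ->
        (forall l, ~~ vacuous xi omega eta l ->
           is_argmin (object_cost r c d kappa xi chi omega l eta) (tau l)) ->
        is_argmin (Q r p c d kappa xi chi omega eta) tau,
      (* conversely, every minimizer of the cost solves the per-object problems *)
      forall tau : {ffun 'I_L -> traj K X},
        is_argmin (Q r p c d kappa xi chi omega eta) tau ->
        forall l, ~~ vacuous xi omega eta l ->
          is_argmin (object_cost r c d kappa xi chi omega l eta) (tau l)
    & (* and its remaining entries may be taken to be zero *)
      forall tau : {ffun 'I_L -> traj K X},
        is_argmin (Q r p c d kappa xi chi omega eta) tau ->
        is_argmin (Q r p c d kappa xi chi omega eta)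
          [ffun l => if vacuous xi omega eta l then traj0 K X else tau l]].
Proof.
split=> [tau _ | tau | tau]; try by move/Q_argminP.
(* Zeroing the vacuous entries keeps all the entries that the criterion constrains. *)
move=> /Q_argminP taumin; apply/Q_argminP => l lP.
by rewrite ffunE (negPf lP); apply: taumin.
Qed.
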